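(* Let $f=f(x,z)\in\mathbb{Q}\langle\langle x,z\rangle\rangle$ be admissible. Then, for every $n\ge 1$, as functions $\mathrm{Sei}(n)\to\mathbb{Q}\langle\langle x_1,\dots,x_n\rangle\rangle$, $$\tilde\chi_{f(x,z)}=\chi_{\tilde f(x,1-z)}\qquad\text{and}\qquad \chi_{\hat f}=\hat\chi_f .$$ Therefore also $\bar\chi_{f(x,z)}=\chi_{\bar f(x,1-z)}$.
   Context: $M'$ denotes the transpose of a matrix $M$. A noncommutative power series $f\in\mathbb{Q}\langle\langle x,z\rangle\rangle$ is admissible if for every non-negative integer $m$ it has only finitely many terms of total $x$-degree $m$. Seifert matrices. $\mathrm{Sei}(n)$ is the set of square integer matrices $A=(A_{ij})_{1\le i,j\le n}$ partitioned into $n\times n$ blocks (with square diagonal blocks, of arbitrary sizes) such that $A_{ij}'=A_{ji}$ for $i\neq j$ and $\det(A_{ii}-A_{ii}')=1$ for all $i$. Thus $A-A'$ is block diagonal and invertible over $\mathbb{Z}$, and each diagonal block has even size. Put $Z_A=A(A-A')^{-1}$. Invariants. For $A\in\mathrm{Sei}(n)$ let $X=\mathrm{diag}(x_1,\dots,x_n)$ be the block diagonal matrix, with the same block sizes as $A$, whose $i$-th diagonal block is $x_i$ times the identity, and let $I_{1/2}$ be a diagonal matrix of the same size in which, in each diagonal block, half of the diagonal entries are $0$ and half are $1$. For admissible $f$, $$\chi_f(A)=\mathrm{tr}\big(f(X,Z_A)-f(X,I_{1/2})\big)\in\mathbb{Q}\langle\langle x_1,\dots,x_n\rangle\rangle$$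 (independent of how the $0$'s and $1$'s are distributed in $I_{1/2}$). Involutions. On both $\mathbb{Q}\langle\langle x,z\rangle\rangle$ and $\mathbb{Q}\langle\langle x_1,\dots,x_n\rangle\rangle$ define (continuous, $\mathbb{Q}$-linear) anti-involutions $f\mapsto\tilde f$ and $f\mapsto\bar f$ (so $\widetilde{fg}=\tilde g\tilde f$, $\overline{fg}=\bar g\bar f$) by $\tilde x=x$, $\tilde z=z$, $\tilde x_i=x_i$, and $\bar x=-x(1+x)^{-1}$, $\bar z=z$, $\bar x_i=-x_i(1+x_i)^{-1}$; and an involution $f\mapsto\hat f$ ($\widehat{fg}=\hat f\hat g$) by $\hat x=\bar x$, $\hat z=z$, $\hat x_i=\bar x_i$. The functions $\tilde\chi_f,\bar\chi_f,\hat\chi_f$ are obtained by applying the corresponding operation on $\mathbb{Q}\langle\langle x_1,\dots,x_n\rangle\rangle$ to the values of $\chi_f$. The notation $\tilde f(x,1-z)$ (resp. $\bar f(x,1-z)$) means: substitute $1-z$ for $z$ in $\tilde f$ (resp. $\bar f$); if $f$ is admissible then so are $\tilde f,\bar f,\hat f$, and substituting $1-z$ for $z$ in an admissible series is well defined and gives an admissible series. *)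

(* Defs.v *)
From HB Require Import structures.
From mathcomp Require Import all_boot all_order all_algebra finmap.
From mathcomp Require Import mathcomp_extra boolp classical_sets functions.
From mathcomp Require Import cardinality fsbigop.

Set Implicit Arguments.
Unset Strict Implicit.
Unset Printing Implicit Defensive.

Import GRing.Theory.
Local Open Scope ring_scope.

(* Q<<I>>: a noncommutative power series over the alphabet I is the family of  *)
(* its rational coefficients, indexed by the words in I.                       *)
Record ncseries (I : choiceType) := NCSeries { nccoef : seq I -> rat }.
Arguments NCSeries {I}.

Section NCSeriesRing.
Variable I : choiceType.
Implicit Types (f g h : ncseries I) (u v w : seq I).

Lemma ncseriesP f g : nccoef f =1 nccoef g -> f = g.
Proof. by case: f g => [f] [g] /= fg; congr NCSeries; apply/funext. Qed.

HB.instance Definition _ := gen_eqMixin (ncseries I).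
HB.instance Definition _ := gen_choiceMixin (ncseries I).

Definition nczero : ncseries I := NCSeries (fun=> 0).
Definition ncopp f := NCSeries (fun u => - nccoef f u).
Definition ncadd f g := NCSeries (fun u => nccoef f u + nccoef g u).

Fact ncaddA : associative ncadd.
Proof. by move=> f g h; apply: ncseriesP => u; rewrite /= addrA. Qed.
Fact ncaddC : commutative ncadd.
Proof. by move=> f g; apply: ncseriesP => u; rewrite /= addrC. Qed.
Fact ncadd0 : left_id nczero ncadd.
Proof. by move=> f; apply: ncseriesP => u; rewrite /= add0r. Qed.
Fact ncaddN : left_inverse nczero ncopp ncadd.
Proof. by move=> f; apply: ncseriesP => u; rewrite /= addNr. Qed.
HB.instance Definition _ :=
  GRing.isZmodule.Build (ncseries I) ncaddA ncaddC ncadd0 ncaddN.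

Definition ncone : ncseries I := NCSeries (fun u => (u == [::])%:R).
Definition ncmul f g := NCSeries (fun u =>
  \sum_(k < (size u).+1) nccoef f (take k u) * nccoef g (drop k u)).

Definition ncshift (a : I) f := NCSeries (fun u => nccoef f (a :: u)).

Fact ncmul_nil f g : nccoef (ncmul f g) [::] = nccoef f [::] * nccoef g [::].
Proof. by rewrite /= big_ord_recl big_ord0 addr0. Qed.

Fact ncmul_cons f g a u : nccoef (ncmul f g) (a :: u) =
  nccoef f [::] * nccoef g (a :: u) + nccoef (ncmul (ncshift a f) g) u.
Proof. by rewrite /= big_ord_recl. Qed.

Fact ncmulDl : left_distributive ncmul +%R.
Proof.
move=> f g h; apply: ncseriesP => u /=.
by rewrite -big_split; apply: eq_bigr => k _ /=; rewrite mulrDl.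
Qed.
Fact ncmulDr : right_distributive ncmul +%R.
Proof.
move=> f g h; apply: ncseriesP => u /=.
by rewrite -big_split; apply: eq_bigr => k _ /=; rewrite mulrDr.
Qed.

Fact ncmulA : associative ncmul.
Proof.
move=> f g h; apply: ncseriesP => u; elim: u f => [|a u IHu] f.
  by rewrite !ncmul_nil mulrA.
rewrite !ncmul_cons IHu ncmul_nil mulrDr mulrA -addrA; congr (_ + _).
have -> : ncshift a (ncmul f g) =
    NCSeries (fun v => nccoef f [::] * nccoef (ncshift a g) v)
    + ncmul (ncshift a f) g.
  by apply: ncseriesP => v; rewrite [LHS]ncmul_cons.
rewrite ncmulDl [RHS]/=; congr (_ + _); rewrite mulr_sumr.
by apply: eq_bigr => k _; rewrite mulrA.
Qed.

Fact ncmul1 : left_id ncone ncmul.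
Proof.
move=> f; apply: ncseriesP => u /=.
rewrite big_ord_recl /= take0 drop0 eqxx mul1r big1 ?addr0 // => k _.
by case: u k => [|a u] k; [case: k | rewrite mul0r].
Qed.
Fact nc1mul : right_id ncone ncmul.
Proof.
move=> f; apply: ncseriesP => u /=.
rewrite big_ord_recr /= take_size drop_size eqxx mulr1 big1 ?add0r // => k _.
by rewrite -size_eq0 size_drop subn_eq0 leqNgt ltn_ord mulr0.
Qed.
Fact ncone_neq0 : ncone != 0.
Proof. by apply/eqP => /(congr1 (fun f => nccoef f [::])) /eqP. Qed.

HB.instance Definition _ := GRing.Zmodule_isNzRing.Build (ncseries I)
  ncmulA ncmul1 nc1mul ncmulDl ncmulDr ncone_neq0.

Definition ncscale (c : rat) f := NCSeries (fun u => c * nccoef f u).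

Fact ncscaleA c d f : ncscale c (ncscale d f) = ncscale (c * d) f.
Proof. by apply: ncseriesP => u; rewrite /= mulrA. Qed.
Fact ncscale1 : left_id 1 ncscale.
Proof. by move=> f; apply: ncseriesP => u; rewrite /= mul1r. Qed.
Fact ncscaleDr : right_distributive ncscale +%R.
Proof. by move=> c f g; apply: ncseriesP => u; rewrite /= mulrDr. Qed.
Fact ncscaleDl f : {morph ncscale^~ f : c d / c + d}.
Proof. by move=> c d; apply: ncseriesP => u; rewrite /= mulrDl. Qed.
HB.instance Definition _ := GRing.Zmodule_isLmodule.Build rat (ncseries I)
  ncscaleA ncscale1 ncscaleDr ncscaleDl.

Fact ncscaleAl (c : rat) f g : c *: (f * g) = (c *: f) * g.
Proof.
apply: ncseriesP => u /=; rewrite mulr_sumr.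
by apply: eq_bigr => k _; rewrite mulrA.
Qed.
HB.instance Definition _ :=
  GRing.Lmodule_isLalgebra.Build rat (ncseries I) ncscaleAl.
Fact ncscaleAr (c : rat) f g : c *: (f * g) = f * (c *: g).
Proof.
apply: ncseriesP => u /=; rewrite mulr_sumr.
by apply: eq_bigr => k _; rewrite mulrCA.
Qed.
HB.instance Definition _ :=
  GRing.Lalgebra_isAlgebra.Build rat (ncseries I) ncscaleAr.

Definition ncvar (i : I) : ncseries I := NCSeries (fun u => (u == [:: i])%:R).

(* (1 + x_i)^-1 = \sum_k (-1)^k x_i^k                                          *)
Definition ncinv1p (i : I) : ncseries I :=
  NCSeries (fun u => if all (pred1 i) u then (-1) ^+ size u else 0).

Definition ncbarvar (i : I) : ncseries I := - ncvar i * ncinv1p i.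

(* The sum of a family of series, for coefficientwise convergence with Q       *)
(* discrete: each coefficient of the sum is a finitely supported sum. Pitfall: *)
(* \sum_(t \in setT) is 0 on an infinite support. Supports are always finite   *)
(* for the (anti-)involutions below; for subst_1subz and for ncmxeval in chi   *)
(* they are finite when the series is admissible.                              *)
Definition ncsum (T : choiceType) (F : T -> ncseries I) : ncseries I :=
  NCSeries (fun u => \sum_(t \in setT) nccoef (F t) u).

End NCSeriesRing.

(* The continuous Q-linear extension of the (anti-)homomorphism that sends the *)
(* letter i to g i.                                                            *)
Definition ncsubst (I J : choiceType) (g : I -> ncseries J) (f : ncseries I) :
    ncseries J :=
  ncsum (fun w : seq I => nccoef f w *: \prod_(i <- w) g i).

Definition ncantisubst (I J : choiceType) (g : I -> ncseries J)
    (f : ncseries I) : ncseries J :=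
  ncsum (fun w : seq I => nccoef f w *: \prod_(i <- rev w) g i).

Definition ncmxeval (I J : choiceType) (N : nat)
    (M : I -> 'M[ncseries J]_N) (f : ncseries I) : 'M[ncseries J]_N :=
  \matrix_(s, t) ncsum (fun w : seq I => nccoef f w *: (\prod_(i <- w) M i) s t).

Variant letter := Lx | Lz.

Definition bool_of_letter l := if l is Lx then true else false.
Definition letter_of_bool (b : bool) := if b then Lx else Lz.
Fact bool_of_letterK : cancel bool_of_letter letter_of_bool.
Proof. by case. Qed.
HB.instance Definition _ := Countable.copy letter (can_type bool_of_letterK).

Definition lettercase (T : Type) (a b : T) (l : letter) : T :=
  if l is Lx then a else b.

Definition admissible (f : ncseries letter) : Prop :=
  forall m : nat,
    finite_set [set w : seq letter | nccoef f w != 0 /\ count_mem Lx w = m].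

Definition subst_1subz (f : ncseries letter) : ncseries letter :=
  ncsubst (lettercase (ncvar Lx) (1 - ncvar Lz)) f.

(* f |-> \tilde f, on both Q<<x,z>> and Q<<x_1,...,x_n>>                       *)
Definition nctilde (I : choiceType) : ncseries I -> ncseries I :=
  ncantisubst (@ncvar I).

Definition bar_xz : ncseries letter -> ncseries letter :=
  ncantisubst (lettercase (ncbarvar Lx) (ncvar Lz)).
Definition hat_xz : ncseries letter -> ncseries letter :=
  ncsubst (lettercase (ncbarvar Lx) (ncvar Lz)).

Definition bar_n (n : nat) : ncseries 'I_n -> ncseries 'I_n :=
  ncantisubst (@ncbarvar 'I_n).
Definition hat_n (n : nat) : ncseries 'I_n -> ncseries 'I_n :=
  ncsubst (@ncbarvar 'I_n).

Record Sei (n : nat) := MkSei {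
  sei_size : 'I_n -> nat;
  sei_mx :> 'M[int]_(\sum_i sei_size i);
  sei_tr : forall i j, i != j ->
    (submxblock sei_mx i j)^T = submxblock sei_mx j i;
  sei_det : forall i,
    \det (submxblock sei_mx i i - (submxblock sei_mx i i)^T) = 1
}.

Section Chi.
Variable n : nat.

Definition Zmx (A : Sei n) : 'M[int]_(\sum_i sei_size A i) :=
  sei_mx A *m invmx (sei_mx A - (sei_mx A)^T).

Definition Xmx (p : 'I_n -> nat) : 'M[ncseries 'I_n]_(\sum_i p i) :=
  \mxdiag_(i < n) (ncvar i)%:M.

(* One choice of I_{1/2}: the diagonal of each block is 0, 1, 0, 1, ...; see   *)
(* chi_indep for the independence of this choice.                              *)
Definition Ihalf (p : 'I_n -> nat) : 'M[ncseries 'I_n]_(\sum_i p i) :=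
  \mxdiag_(i < n) diag_mx (\row_(k < p i) (odd k)%:R).

Definition chi (f : ncseries letter) (A : Sei n) : ncseries 'I_n :=
  \tr (ncmxeval (lettercase (Xmx (sei_size A)) (map_mx intr (Zmx A))) f
       - ncmxeval (lettercase (Xmx (sei_size A)) (Ihalf (sei_size A))) f).

End Chi.

Lemma ncshift_var (I : choiceType) (a i : I) :
  ncshift a (ncvar i) = (a == i)%:R.
Proof.
by apply: ncseriesP => v /=; rewrite eqseq_cons; case: (a == i).
Qed.

Lemma nctildeE (I : choiceType) (f : ncseries I) u :
  nccoef (nctilde f) u = nccoef f (rev u).
Proof.
have varE (w v : seq I) : nccoef (\prod_(i <- w) ncvar i) v = (v == w)%:R.
  elim: w v => [|a w IHw] v; first by rewrite big_nil.
  rewrite big_cons; case: v => [|b v].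
    by rewrite [LHS]ncmul_nil mul0r.
  rewrite [LHS]ncmul_cons mul0r add0r eqseq_cons.
  rewrite ncshift_var; case: (eqVneq b a) => [_|_].
    by rewrite -[LHS]/(nccoef (1 * \prod_(i <- w) ncvar i) v) mul1r IHw.
  by rewrite -[LHS]/(nccoef (0 * \prod_(i <- w) ncvar i) v) mul0r.
rewrite /= (fsbigTE [fset rev u]%fset) /=.
  by rewrite big_seq_fset1 revK varE eqxx mulr1.
move=> w; rewrite in_fset1 varE => uw; rewrite (_ : _ == _ = false) ?mulr0 //.
by apply/eqP => uE; move: uw; rewrite uE revK eqxx.
Qed.

Lemma ncinv1pK (I : choiceType) (i : I) :
  (1 + ncvar i) * ncinv1p i = 1 /\ ncinv1p i * (1 + ncvar i) = 1.
Proof.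
split; apply: ncseriesP => u.
  rewrite mulrDl mul1r; case: u => [|a u].
    by rewrite [LHS]/= big_ord_recl big_ord0 mul0r !addr0.
  rewrite -[LHS]/(nccoef (ncinv1p i) (a :: u)
    + nccoef (ncmul (ncvar i) (ncinv1p i)) (a :: u)) ncmul_cons mul0r add0r.
  rewrite ncshift_var.
  case: (eqVneq a i) => [->|ai].
    rewrite -[X in _ + X]/(nccoef (1 * ncinv1p i) u) mul1r /= eqxx /= exprS.
    by case: ifP => _; rewrite ?mulN1r ?addNr ?addr0.
  rewrite -[X in _ + X]/(nccoef (0 * ncinv1p i) u) mul0r /= (negPf ai) addr0.
  by [].
rewrite mulrDr mulr1; case/lastP: u => [|u a].
  by rewrite [LHS]/= big_ord_recl big_ord0 mulr0 !addr0.
rewrite /= size_rcons big_ord_recr big_ord_recr /=.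
rewrite -(size_rcons u a) drop_size mulr0 addr0.
rewrite -cats1 take_size_cat // drop_size_cat // big1 => [|k _].
  rewrite add0r cats1 all_rcons size_rcons exprSr eqseq_cons eqxx andbT /=.
  rewrite -size_eq0 size_rcons /=.
  case: (eqVneq a i) => _ /=; last by rewrite mulr0 addr0.
  by case: ifP => _; rewrite ?mulrN1 mulr1 ?addNr ?addr0.
rewrite (_ : _ == _ = false) ?mulr0 //; apply/negP => /eqP /(congr1 size)/eqP.
rewrite size_drop size_cat /= addn1 => /eqP E.
by have := ltn_ord k; rewrite -subn_gt0 -ltnS -subSn ?E // ltnW.
Qed.

Lemma sei_skew_unit (n : nat) (A : Sei n) :
  sei_mx A - (sei_mx A)^T \in unitmx.
Proof.
set S := fun i => submxblock (sei_mx A) i i - (submxblock (sei_mx A) i i)^T.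
have SE : sei_mx A - (sei_mx A)^T = \mxdiag_i S i.
  rewrite -[LHS]submxblockK; apply: eq_mxblock => i j.
  have [<-{j}|ij] := eqVneq i j.
    by rewrite conform_mx_id; apply/matrixP => s t; rewrite !mxE.
  have /matrixP E := sei_tr A ij.
  apply/matrixP => s t; have := E t s; rewrite !mxE => ->; exact: subrr.
have Su i : S i \in unitmx by rewrite unitmxE /S sei_det unitr1.
have : (\mxdiag_i S i) *m (\mxdiag_i invmx (S i)) = 1%:M.
  rewrite /mxdiag mul_mxdiag_mxblock -[RHS]mxdiagZ /mxdiag.
  apply: eq_mxblock => i j; case: eqVneq => [ij|_]; last by rewrite mulmx0.
  case: j / ij.
  by rewrite !conform_mx_id (mulmxV (Su i)).
by rewrite SE => /mulmx1_unit[].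
Qed.

Lemma chi_indep (n : nat) (f : ncseries letter) (A : Sei n)
    (d : forall i, {set 'I_(sei_size A i)}) :
    (forall i, (#|d i|.*2 = sei_size A i)%N) ->
  chi f A =
  \tr (ncmxeval (lettercase (Xmx (sei_size A)) (map_mx intr (Zmx A))) f
       - ncmxeval (lettercase (Xmx (sei_size A))
           (\mxdiag_(i < n) diag_mx (\row_k (k \in d i)%:R))) f).
Proof.
move=> hd.
have trB N (P Q : 'M[ncseries 'I_n]_N) : \tr (P - Q) = \tr P - \tr Q.
  exact: raddfB.
set p := sei_size A in d hd *.
pose G i (b : bool) : ncseries 'I_n := ncsum (fun w : seq letter =>
  nccoef f w *: \prod_(l <- w) lettercase (ncvar i) b%:R l).
have trE (b : forall i, 'I_(p i) -> bool) :
    \tr (ncmxeval (lettercase (Xmx p)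
      (\mxdiag_(i < n) diag_mx (\row_k (b i k)%:R))) f)
    = \sum_i \sum_k G i (b i k).
  have prodE (w : seq letter) : \prod_(l <- w) lettercase (Xmx p)
      (\mxdiag_(i < n) diag_mx (\row_k (b i k)%:R)) l =
    \mxdiag_(i < n) diag_mx (\row_k
      \prod_(l <- w) lettercase (ncvar i) (b i k)%:R l).
    elim: w => [|l w IHw].
      rewrite big_nil -[LHS]/(1%:M) -mxdiagZ; apply: eq_mxdiag => i.
      by rewrite -diag_const_mx; congr diag_mx; apply/rowP => k;
         rewrite !mxE big_nil.
    rewrite big_cons IHw.
    have -> : lettercase (Xmx p)
        (\mxdiag_(i < n) diag_mx (\row_k (b i k)%:R)) l =
      \mxdiag_(i < n) diag_mx (\row_k lettercase (ncvar i) (b i k)%:R l).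
      case: l => //=; apply: eq_mxdiag => i.
      by rewrite -diag_const_mx; congr diag_mx; apply/rowP => k; rewrite !mxE.
    rewrite -!diag_mxrow -[LHS]/(_ *m _) mulmx_diag; congr diag_mx.
    by apply/rowP => s; rewrite !mxE big_cons.
  rewrite -[ncmxeval _ _]submxblockK mxtrace_mxblock.
  apply: eq_bigr => i _; apply: eq_bigr => k _; rewrite !mxE /G.
  congr ncsum; apply/funext => w; rewrite prodE; congr (_ *: _).
  have := submxblock_diag (fun i => diag_mx (\row_(k < p i)
      \prod_(l <- w) lettercase (ncvar i) (b i k)%:R l)) i.
  by move/matrixP => /(_ k k); rewrite [LHS]mxE => ->; rewrite !mxE eqxx.
apply: etrans (trB _ _ _) _; apply: etrans (esym (trB _ _ _)).
apply: (congr1 (fun t => _ - t)).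
apply: etrans (trE (fun i k => odd k)) _.
apply: etrans (esym (trE (fun i k => k \in d i))).
apply: eq_bigr => i _.
have -> : \sum_(k < p i) G i (odd k) = G i true *+ #|d i| + G i false *+ #|d i|.
  rewrite -[in LHS]hd -(big_mkord xpredT (fun k => G i (odd k))).
  elim: #|d i| => [|q IHq]; first by rewrite big_geq // !mulr0n addr0.
  rewrite doubleS !big_nat_recr //= IHq odd_double /= !mulrSr.
  by rewrite -addrA [RHS]addrACA [in RHS](addrC (G i true)).
rewrite (bigID (mem (d i))) /=; congr (_ + _).
  by rewrite (eq_bigr (fun=> G i true)) ?sumr_const // => k ->.
rewrite (eq_bigr (fun=> G i false)) => [|k /negPf -> //].
rewrite (eq_bigl (mem (~: d i))) => [|k]; last by rewrite !inE.
rewrite sumr_const; congr (_ *+ _).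
by have := cardsC (d i); rewrite card_ord -[RHS]hd -addnn => /addnI.
Qed.

(* Main.v *)
From HB Require Import structures.
From mathcomp Require Import all_boot all_order all_algebra finmap.
From mathcomp Require Import boolp classical_sets.
From mathcomp Require Import cardinality fsbigop.
Require Import Defs.

(** Put S = A - A' and Z = A S^-1.  Since S' = -S, transposing Z S = A gives
    S Z' = -A' = (1 - Z) S, so Z' is conjugate to 1 - Z by S.  The matrix S is
    block diagonal, hence commutes with X, and its entries are integers, hence
    central; so the words w(X, Z') and w(X, 1 - Z) are conjugate and have the
    same trace even though the base ring is not commutative.  On the other
    hand, tilde is an anti-automorphism that fixes the x_i and the integers, so
    applying it to the entries of w(X, Z) and transposing gives w^rev(X, Z').
    Together (tr_map_tilde_ncmxeval, mxtrace_ncmxeval_Zmx) these give the first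
    identity for the Z-part of chi.  For the other part, 1 - I_1/2 is another
    valid choice of I_1/2, because each block of A has even size: an
    alternating matrix of odd size has determinant 0 (sei_size_even).  This is
    tilde_chi.

    For the second identity, both sides are the trace of f(bar X, Z), where
    bar X is block scalar with entries bar x_i: on the left because
    y = bar x is characterised by (1 + x) y = - x, and 1 + X is invertible
    (ncmxeval_hat); on the right because hat is multiplicative and fixes the
    integers (map_hat_ncmxeval).  This is hat_chi.  The third identity follows,
    as bar is tilde after hat.

    The remaining work is convergence.  Series are summed coefficientwise, so
    every rearrangement needs finite supports.  One mechanism provides them
    all: a series f is finitary for a set Q of letters when it has finitely
    many terms of each Q-degree (admissibility, for Q = {x}), and the letters
    of Q are only ever replaced by series, or matrices, without constant term.
    A word of Q-degree d then contributes nothing to coefficients of degree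
    below d, and each coefficient of a substituted series is a finite sum.
    Substitutions are composed by exchanging two such sums (ncsum_comp), which
    reduces every identity to words, where it is proved letter by letter. *)

Set Implicit Arguments.
Unset Strict Implicit.
Unset Printing Implicit Defensive.

Import GRing.Theory.
Local Open Scope ring_scope.

(** * Coefficientwise sums of families of series *)

Lemma nccoef_sum (J : choiceType) (T : Type) (r : seq T) (P : pred T)
    (F : T -> ncseries J) u :
  nccoef (\sum_(t <- r | P t) F t) u = \sum_(t <- r | P t) nccoef (F t) u.
Proof. by elim/big_rec2: _ => //= t x y _ <-. Qed.

Lemma nccoefM (J : choiceType) (f g : ncseries J) u :
  nccoef (f * g) u =
  \sum_(k < (size u).+1) nccoef f (take k u) * nccoef g (drop k u).
Proof. by []. Qed.

Lemma nccoef1 (J : choiceType) (u : seq J) : nccoef 1 u = (u == [::])%:R.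
Proof. by []. Qed.

Lemma nccoef_varM (J : choiceType) (a : J) (f : ncseries J) u :
  nccoef (ncvar a * f) u =
  if u is b :: v then (b == a)%:R * nccoef f v else 0.
Proof.
case: u => [|b v]; first by rewrite [LHS]ncmul_nil mul0r.
rewrite [LHS]ncmul_cons mul0r add0r ncshift_var.
case: (b == a); first by rewrite -[LHS]/(nccoef (1 * f) v) !mul1r.
by rewrite -[LHS]/(nccoef (0 * f) v) !mul0r.
Qed.

(** Coefficientwise finiteness of the supports: the case in which the total
    operator ncsum is the true sum rather than a default value. *)
Definition summable (J T : choiceType) (F : T -> ncseries J) : Prop :=
  forall u, exists X : {fset T}, forall t, t \notin X -> nccoef (F t) u = 0.

Section Sums.
Variables (J T : choiceType).
Implicit Types F G : T -> ncseries J.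

Lemma ncsumE F u (X : {fset T}) :
  (forall t, t \notin X -> nccoef (F t) u = 0) ->
  nccoef (ncsum F) u = \sum_(t <- X) nccoef (F t) u.
Proof. by move=> FX; rewrite /= (fsbigTE X). Qed.

Lemma eq_ncsum F G : F =1 G -> ncsum F = ncsum G.
Proof. by move=> FG; congr ncsum; apply/funext. Qed.

Lemma ncsum_scale c F : ncsum (fun t => c *: F t) = c *: ncsum F.
Proof. by apply: ncseriesP => u; rewrite /= mulr_fsumr. Qed.

Lemma ncsumN F : ncsum (fun t => - F t) = - ncsum F.
Proof.
by rewrite -scaleN1r -ncsum_scale; apply: eq_ncsum => t; rewrite scaleN1r.
Qed.

(** A coefficient of c * F t at u only involves F t at the finitely many
    suffixes of u, which can be covered simultaneously. *)
Lemma summable_drops F u : summable F ->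
  exists X : {fset T}, forall t, t \notin X ->
    forall k, nccoef (F t) (drop k u) = 0.
Proof.
move=> sF; elim: u => [|a u [X FX]].
  by have [X FX] := sF [::]; exists X => t tX [|k]; exact: FX.
have [Y FY] := sF (a :: u); exists (X `|` Y)%fset => t.
by rewrite in_fsetU negb_or => /andP[tX tY] [|k]; [exact: FY | exact: FX].
Qed.

Lemma summableMl (c : ncseries J) F :
  summable F -> summable (fun t => c * F t).
Proof.
move=> sF u; have [X FX] := summable_drops u sF.
by exists X => t tX; rewrite nccoefM big1 // => k _; rewrite FX ?mulr0.
Qed.

Lemma ncsumMl (c : ncseries J) F : summable F ->
  ncsum (fun t => c * F t) = c * ncsum F.
Proof.
move=> sF; apply: ncseriesP => u; rewrite nccoefM.
have [X FX] := summable_drops u sF.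
rewrite (@ncsumE _ _ X) => [|t tX]; last first.
  by rewrite nccoefM big1 // => k _; rewrite FX ?mulr0.
rewrite exchange_big /=; apply: eq_bigr => k _.
by rewrite -mulr_sumr (fsbigTE X) // => t /FX.
Qed.

Lemma ncsum_sum (K : finType) (F : K -> T -> ncseries J) :
  (forall k, summable (F k)) ->
  ncsum (fun t => \sum_k F k t) = \sum_k ncsum (F k).
Proof.
move=> sF; apply: ncseriesP => u; rewrite nccoef_sum.
have /choice [X FX] := fun k => sF k u.
pose Y := (\bigcup_(k <- enum K) X k)%fset.
have FY k t : t \notin Y -> nccoef (F k t) u = 0.
  move=> tY; apply: FX; apply: contraNN tY => tX.
  by apply/bigfcupP; exists k; rewrite ?mem_enum.
rewrite (@ncsumE _ _ Y) => [|t tY]; last first.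
  by rewrite nccoef_sum big1 // => k _; exact: FY.
under eq_bigr do rewrite nccoef_sum.
by rewrite exchange_big; apply: eq_bigr => k _; rewrite (@ncsumE _ _ Y) // => t /FY.
Qed.

Lemma ncsumD F G : summable F -> summable G ->
  ncsum (fun t => F t + G t) = ncsum F + ncsum G.
Proof.
move=> sF sG; pose H (b : bool) := if b then F else G.
transitivity (ncsum (fun t => \sum_b H b t)).
  by apply: eq_ncsum => t; rewrite big_bool.
by rewrite ncsum_sum ?big_bool // => -[].
Qed.

(** Fubini for the linear map that sends each word v to H v: it commutes with
    the sum of F as soon as, in each degree, only finitely many pairs (t, v)
    contribute. *)
Lemma ncsum_comp (I : choiceType) (F : T -> ncseries I)
    (H : seq I -> ncseries J) :
  (forall u, exists (X : {fset T}) (Y : {fset seq I}), forall t v,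
     nccoef (F t) v != 0 -> nccoef (H v) u != 0 -> t \in X /\ v \in Y) ->
  ncsum (fun v => nccoef (ncsum F) v *: H v) =
  ncsum (fun t => ncsum (fun v => nccoef (F t) v *: H v)).
Proof.
move=> sFH; apply: ncseriesP => u; have [X [Y XY]] := sFH u.
have XY0 t v : ~~ ((t \in X) && (v \in Y)) ->
    nccoef (F t) v * nccoef (H v) u = 0.
  move=> ntv; apply/eqP; rewrite mulf_eq0 -[_ || _]negbK negb_or.
  by apply: contraNN ntv => /andP[a b]; apply/andP; exact: XY.
have EL v : nccoef (nccoef (ncsum F) v *: H v) u =
    \sum_(t <- X) nccoef (F t) v * nccoef (H v) u.
  rewrite /= mulr_fsuml (fsbigTE X) // => t tX.
  by apply: XY0; rewrite (negPf tX).
have ER t : nccoef (ncsum (fun v => nccoef (F t) v *: H v)) u =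
    \sum_(v <- Y) nccoef (F t) v * nccoef (H v) u.
  by rewrite /= (fsbigTE Y) // => v vY; apply: XY0; rewrite (negPf vY) andbF.
rewrite [LHS](fsbigTE Y) => [|v vY]; last first.
  by rewrite EL big1 // => t _; apply: XY0; rewrite (negPf vY) andbF.
rewrite (eq_bigr _ (fun v _ => EL v)) exchange_big /=.
rewrite [RHS](fsbigTE X) => [|t tX]; last first.
  by apply: etrans (ER t) _; rewrite big1 // => v _; apply: XY0; rewrite (negPf tX).
by apply: eq_bigr => t _; apply: etrans (esym (ER t)).
Qed.

End Sums.

Lemma ncsum_one (I J : choiceType) (K : seq I -> ncseries J) :
  ncsum (fun w => nccoef 1 w *: K w) = K [::].
Proof.
apply: ncseriesP => u; rewrite (@ncsumE _ _ _ _ [fset [::]]%fset).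
  by rewrite big_seq_fset1 nccoef1 eqxx scale1r.
by move=> w; rewrite in_fset1 => w0; rewrite nccoef1 (negPf w0) scale0r.
Qed.

(** A letter in front of f is absorbed by the reindexing w |-> a :: w, a
    bijection between supports: both sides agree even at coefficients where
    ncsum takes its default value. *)
Lemma ncsum_varM (I J : choiceType) (K : seq I -> ncseries J) a
    (f : ncseries I) :
  ncsum (fun w => nccoef (ncvar a * f) w *: K w) =
  ncsum (fun w => nccoef f w *: K (a :: w)).
Proof.
apply: ncseriesP => u /=.
pose P := [set a :: w | w in [set: seq I]]%classic.
transitivity (\sum_(w \in P) nccoef (ncvar a * f) w * nccoef (K w) u).
  apply/esym/fsbig_widen => // w [_ Pw].
  change (nccoef (ncvar a * f) w * nccoef (K w) u = 0); rewrite nccoef_varM.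
  case: w Pw => [|b v] Pv; first by rewrite mul0r.
  case: eqP => [ba|_]; last by rewrite !mul0r.
  by case: Pv; exists v; rewrite // ba.
rewrite fsbig_image; last by move=> v w _ _ [].
by apply: eq_fsbigr => w _; rewrite nccoef_varM eqxx mul1r.
Qed.

(** * Degrees and finiteness *)

(** The degree counts only the letters in P: all the letters in the variables
    x_i, but x alone in the variables x, z, where z has degree 0. *)
Definition vanish_below (J : choiceType) (P : pred J) (d : nat)
    (h : ncseries J) : Prop :=
  forall u, (count P u < d)%N -> nccoef h u = 0.

Section Order.
Variables (J : choiceType) (P : pred J).
Implicit Types f g h : ncseries J.

Lemma vanish_belowN d h : vanish_below P d h -> vanish_below P d (- h).
Proof. by move=> hd u ud; rewrite /= hd ?oppr0. Qed.

Lemma vanish_below_sum d (T : Type) (r : seq T) (F : T -> ncseries J) :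
  (forall t, vanish_below P d (F t)) -> vanish_below P d (\sum_(t <- r) F t).
Proof. by move=> Fd u ud; rewrite nccoef_sum big1 // => t _; exact: Fd. Qed.

Lemma vanish_belowM d e g h : vanish_below P d g -> vanish_below P e h ->
  vanish_below P (d + e) (g * h).
Proof.
move=> gd he u ude; rewrite nccoefM big1 // => k _.
have [kd|kd] := ltnP (count P (take k u)) d; first by rewrite gd ?mul0r.
rewrite he ?mulr0 // -(ltn_add2l d); apply: leq_ltn_trans ude.
by rewrite -[X in (_ <= count P X)%N](cat_take_drop k) count_cat leq_add2r.
Qed.

Lemma vanish_below_var a : P a -> vanish_below P 1 (ncvar a).
Proof.
move=> Pa u; rewrite /=; case: eqP => [->|//]; by rewrite /= Pa.
Qed.

Lemma vanish_below_barvar a : P a -> vanish_below P 1 (ncbarvar a).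
Proof.
move=> Pa; apply: (@vanish_belowM 1 0) => //.
exact/vanish_belowN/vanish_below_var.
Qed.

End Order.

(** Admissibility with respect to the letters in Q.  Bounding the degree
    instead of fixing it, and giving a finite cover instead of a finite set,
    makes the closure properties direct. *)
Definition finitary (I : choiceType) (Q : pred I) (f : ncseries I) : Prop :=
  forall m, exists X : {fset seq I}, forall w,
    (count Q w <= m)%N -> w \notin X -> nccoef f w = 0.

Section Finitary.
Variables (I : choiceType) (Q : pred I).
Implicit Types f g : ncseries I.

Lemma finitaryD f g : finitary Q f -> finitary Q g -> finitary Q (f + g).
Proof.
move=> ff fg m; have [X fX] := ff m; have [Y gY] := fg m.
exists (X `|` Y)%fset => w wm; rewrite in_fsetU negb_or => /andP[wX wY].
by rewrite /= fX ?gY ?addr0.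
Qed.

Lemma finitaryN f : finitary Q f -> finitary Q (- f).
Proof.
by move=> ff m; have [X fX] := ff m; exists X => w wm wX; rewrite /= fX ?oppr0.
Qed.

Lemma finitary1 : finitary Q 1.
Proof.
by move=> m; exists [fset [::]]%fset => w _; rewrite in_fset1 nccoef1 => /negPf ->.
Qed.

Lemma finitary_var a : finitary Q (ncvar a).
Proof.
by move=> m; exists [fset [:: a]]%fset => w _; rewrite in_fset1 /= => /negPf ->.
Qed.

Lemma finitary_inv1p a : Q a -> finitary Q (ncinv1p a).
Proof.
move=> Qa m; exists [fset nseq (val k) a | k : 'I_m.+1]%fset => w wm wX /=.
case: ifP => // /all_pred1P wE; case/negP: wX; apply/imfsetP.
have wm1 : (size w < m.+1)%N by move: wm; rewrite {1}wE count_nseq Qa mul1n.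
by exists (Ordinal wm1).
Qed.

(** A factorisation splits the degree, so the terms of degree at most m
    come from products of terms of degree at most m. *)
Lemma finitaryM f g : finitary Q f -> finitary Q g -> finitary Q (f * g).
Proof.
move=> ff fg m; have [X fX] := ff m; have [Y gY] := fg m.
exists [fset (p ++ q)%SEQ | p in X, q in Y]%fset => w wm wXY.
rewrite nccoefM big1 // => k _.
have := wm; rewrite -[X in (count Q X <= _)%N](cat_take_drop k) count_cat => km.
have [tX|tX] := boolP (take k w \in X); last first.
  by rewrite fX ?mul0r // (leq_trans (leq_addr _ _) km).
rewrite gY ?mulr0 // ?(leq_trans (leq_addl _ _) km) //.
apply: contraNN wXY => dY; apply/imfset2P; exists (take k w) => //.
by exists (drop k w); rewrite // cat_take_drop.
Qed.

Lemma finitary_prod (T : Type) (r : seq T) (F : T -> ncseries I) :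
  (forall t, finitary Q (F t)) -> finitary Q (\prod_(t <- r) F t).
Proof.
by move=> fF; apply: big_ind => //; [exact: finitary1 | exact: finitaryM].
Qed.

Lemma finitary_barvar a : Q a -> finitary Q (ncbarvar a).
Proof.
by move=> Qa; apply/finitaryM/finitary_inv1p => //; exact/finitaryN/finitary_var.
Qed.

Lemma finitary_tilde f : finitary Q f -> finitary Q (nctilde f).
Proof.
move=> ff m; have [X fX] := ff m.
exists [fset rev w | w in X]%fset => w wm wX; rewrite nctildeE fX ?count_rev //.
by apply: contraNN wX => wX; apply/imfsetP; exists (rev w); rewrite ?revK.
Qed.

End Finitary.

Lemma finite_words (n m : nat) : exists Y : {fset seq 'I_n},
  forall w : seq 'I_n, (size w <= m)%N -> w \in Y.
Proof.
exists [fset bseqval b | b : m.-bseq 'I_n]%fset => w wm.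
by apply/imfsetP; exists (Bseq wm).
Qed.

Lemma finitaryT (n : nat) (f : ncseries 'I_n) : finitary predT f.
Proof.
move=> m; have [Y mY] := finite_words n m.
by exists Y => w; rewrite count_predT => /mY ->.
Qed.

Lemma finitary_admissible f : admissible f -> finitary (pred1 Lx) f.
Proof.
move=> fa; elim=> [|m [X fX]].
  exists (fset_set [set w | nccoef f w != 0 /\ count_mem Lx w = 0%N]%classic).
  move=> w; rewrite leqn0 in_fset_set // notin_setE /= => /eqP w0.
  by move=> /not_andP[/negP/negPn/eqP | /(_ w0)].
exists (X `|` fset_set
  [set w | nccoef f w != 0 /\ count_mem Lx w = m.+1]%classic)%fset.
move=> w; rewrite leq_eqVlt in_fsetU negb_or => /orP[/eqP wm|wm] /andP[wX].
  rewrite in_fset_set // notin_setE /=.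
  by move=> /not_andP[/negP/negPn/eqP | /(_ wm)].
by rewrite fX.
Qed.

(** * Substitutions and evaluations at matrices *)

(** A family of images of words, filtered in the sense that the continuous
    linear map extending it does not lower the degree. *)
Definition filtered (I J : choiceType) (Q : pred I) (P : pred J)
    (K : seq I -> ncseries J) : Prop :=
  forall w, vanish_below P (count Q w) (K w).

Section Evaluation.
Variables (I J : choiceType) (Q : pred I) (P : pred J).
Implicit Types (f : ncseries I) (g : I -> ncseries J).

(** The convergence of all the substitutions and evaluations below: at a word
    u, only words of degree at most that of u contribute. *)
Lemma summable_filtered K f : finitary Q f -> filtered Q P K ->
  summable (fun w => nccoef f w *: K w).
Proof.
move=> ff KQ u; have [X fX] := ff (count P u); exists X => w wX /=.
have [wu|wu] := leqP (count Q w) (count P u); first by rewrite fX ?mul0r.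
by rewrite KQ ?mulr0.
Qed.

Lemma filtered_prod g : (forall i, Q i -> vanish_below P 1 (g i)) ->
  filtered Q P (fun w => \prod_(i <- w) g i).
Proof.
move=> gQ; elim=> [|a w IHw] //; rewrite big_cons /=.
by apply: vanish_belowM => //; case: (boolP (Q a)) => // /gQ.
Qed.

Lemma ncsubst_varM g f a :
  finitary Q f -> (forall i, Q i -> vanish_below P 1 (g i)) ->
  ncsubst g (ncvar a * f) = g a * ncsubst g f.
Proof.
move=> ff gQ; rewrite /ncsubst ncsum_varM -ncsumMl; last first.
  by apply: summable_filtered => //; exact: filtered_prod.
by apply: eq_ncsum => w; rewrite big_cons -scalerAr.
Qed.

(** The finite supports needed to expand a substitution and then sum over the
    resulting words: a word v of degree at most m arises only from words w of
    degree at most m, which are finitely many in f, and each product over w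
    has finitely many terms of degree at most m. *)
Lemma ncsubst_support g f : finitary Q f ->
  (forall i, finitary P (g i)) -> (forall i, Q i -> vanish_below P 1 (g i)) ->
  forall m, exists (X : {fset seq I}) (Y : {fset seq J}), forall w v,
    (count P v <= m)%N -> nccoef f w != 0 ->
    nccoef (\prod_(i <- w) g i) v != 0 -> w \in X /\ v \in Y.
Proof.
move=> ff gf gQ m; have [X fX] := ff m.
have /choice[Y gY] : forall w : seq I, exists Y : {fset seq J}, forall v,
    (count P v <= m)%N -> v \notin Y -> nccoef (\prod_(i <- w) g i) v = 0.
  by move=> w; apply: finitary_prod gf m.
exists X, (\bigcup_(w <- X) Y w)%fset => w v vm fw gv.
have wX : w \in X.
  apply: contraNT fw => wX; apply/eqP/fX => //; apply: leq_trans vm.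
  rewrite leqNgt; apply: contraNN gv => wv; apply/eqP.
  exact: (filtered_prod gQ).
split=> //; apply/bigfcupP; exists w; first by rewrite wX.
by apply: contraNT gv => /(gY w v vm) ->.
Qed.

Lemma finitary_subst g f : finitary Q f ->
  (forall i, finitary P (g i)) -> (forall i, Q i -> vanish_below P 1 (g i)) ->
  finitary P (ncsubst g f).
Proof.
move=> ff gf gQ m; have [X [Y XY]] := ncsubst_support ff gf gQ m.
exists Y => v vm vY; apply: fsbig1 => w _ /=; apply/eqP; rewrite mulf_eq0.
have [//|fw /=] := eqVneq (nccoef f w) 0; apply: contraNT vY => gv.
by have [] := XY _ _ vm fw gv.
Qed.

Section MatrixEvaluation.
Variables (N : nat) (M : I -> 'M[ncseries J]_N).
Hypothesis MQ : forall i, Q i -> forall s t, vanish_below P 1 (M i s t).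

Lemma filtered_mxprod s t : filtered Q P (fun w => (\prod_(i <- w) M i) s t).
Proof.
move=> w; elim: w s t => [|a w IHw] s t //; rewrite big_cons mxE.
apply: vanish_below_sum => r; apply: vanish_belowM => //=.
by case: (boolP (Q a)) => // /MQ.
Qed.

Lemma summable_mxprod f s t : finitary Q f ->
  summable (fun w => nccoef f w *: (\prod_(i <- w) M i) s t).
Proof.
by move=> ff; apply: summable_filtered ff _; exact: filtered_mxprod.
Qed.

(** Together with linearity, the only form of multiplicativity of the
    evaluation that is used. *)
Lemma ncmxeval_varM f a : finitary Q f ->
  ncmxeval M (ncvar a * f) = M a *m ncmxeval M f.
Proof.
move=> ff; apply/matrixP => s t; rewrite !mxE ncsum_varM.
transitivity (ncsum (fun w => \sum_r M a s r *
    (nccoef f w *: (\prod_(i <- w) M i) r t))).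
  apply: eq_ncsum => w; rewrite big_cons mxE scaler_sumr.
  by apply: eq_bigr => r _; rewrite scalerAr.
rewrite ncsum_sum => [|r]; last by apply/summableMl/summable_mxprod.
by apply: eq_bigr => r _; rewrite mxE ncsumMl //; exact: summable_mxprod.
Qed.

Lemma ncmxevalD f1 f2 : finitary Q f1 -> finitary Q f2 ->
  ncmxeval M (f1 + f2) = ncmxeval M f1 + ncmxeval M f2.
Proof.
move=> ff1 ff2; apply/matrixP => s t; rewrite !mxE.
rewrite -ncsumD; try exact: summable_mxprod.
by apply: eq_ncsum => w; rewrite -scalerDl.
Qed.

Lemma mxtrace_ncmxeval f : finitary Q f ->
  \tr (ncmxeval M f) =
  ncsum (fun w => nccoef f w *: \tr (\prod_(i <- w) M i)).
Proof.
move=> ff; transitivity (ncsum (fun w =>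
    \sum_s nccoef f w *: (\prod_(i <- w) M i) s s)).
  rewrite ncsum_sum => [|s]; last exact: summable_mxprod.
  by apply: eq_bigr => s _; rewrite mxE.
by apply: eq_ncsum => w; rewrite -scaler_sumr.
Qed.

End MatrixEvaluation.

Lemma ncmxevalN (N : nat) (M : I -> 'M[ncseries J]_N) f :
  ncmxeval M (- f) = - ncmxeval M f.
Proof.
apply/matrixP => s t; rewrite !mxE -ncsumN.
by apply: eq_ncsum => w; rewrite -scaleNr.
Qed.

Lemma ncmxeval1 (N : nat) (M : I -> 'M[ncseries J]_N) :
  ncmxeval M 1 = 1%:M.
Proof.
by apply/matrixP => s t; rewrite mxE ncsum_one big_nil.
Qed.

End Evaluation.

(** Evaluation after substitution is evaluation at B, when B i is how g i acts
    by left multiplication after evaluation at M.  Asking for the action on all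
    finitary r, instead of multiplicativity of the evaluation, allows B i to be
    determined by an equation, as for bar x in ncmxeval_hat. *)
Lemma ncmxeval_subst (I J L : choiceType) (Q : pred I) (P : pred J)
    (O : pred L) (N : nat) (g : I -> ncseries J) (f : ncseries I)
    (M : J -> 'M[ncseries L]_N) (B : I -> 'M[ncseries L]_N) :
    finitary Q f -> (forall i, finitary P (g i)) ->
    (forall i, Q i -> vanish_below P 1 (g i)) ->
    (forall j, P j -> forall s t, vanish_below O 1 (M j s t)) ->
    (forall i r, finitary P r ->
       ncmxeval M (g i * r) = B i *m ncmxeval M r) ->
  ncmxeval M (ncsubst g f) = ncmxeval B f.
Proof.
move=> ff gf gQ MP Bg; apply/matrixP => s t; rewrite !mxE ncsum_comp.
  apply: eq_ncsum => w.
  have -> : \prod_(i <- w) B i = ncmxeval M (\prod_(i <- w) g i).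
    elim: w => [|a w IHw]; first by rewrite !big_nil ncmxeval1.
    by rewrite !big_cons IHw Bg //; exact: finitary_prod.
  rewrite mxE -ncsum_scale; apply: eq_ncsum => v.
  by rewrite scalerA.
move=> u; have [X [Y XY]] := ncsubst_support ff gf gQ (count O u).
exists X, Y => w v; rewrite /= mulf_eq0 negb_or => /andP[fw gv] Mv.
apply: XY => //; rewrite leqNgt; apply: contraNN Mv => uv.
by apply/eqP/(filtered_mxprod MP).
Qed.

(** * The anti-involution tilde *)

Section Tilde.
Variable J : choiceType.
Implicit Types f g : ncseries J.

Lemma nctilde_zmod : zmod_morphism (@nctilde J).
Proof.
move=> f g; apply: ncseriesP => u; rewrite nctildeE.
by rewrite -[RHS]/(nccoef (nctilde f) u - nccoef (nctilde g) u) !nctildeE.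
Qed.
HB.instance Definition _ :=
  GRing.isZmodMorphism.Build (ncseries J) (ncseries J) (@nctilde J) nctilde_zmod.

Lemma nctildeM f g : nctilde (f * g) = nctilde g * nctilde f.
Proof.
apply: ncseriesP => u; rewrite nctildeE !nccoefM size_rev.
rewrite (reindex_inj rev_ord_inj); apply: eq_bigr => k _.
have ku : (k <= size u)%N by rewrite -ltnS.
by rewrite [nat_of_ord (rev_ord k)]/= subSS take_rev drop_rev subKn //
  !nctildeE mulrC.
Qed.

Lemma nctilde1 : nctilde (1 : ncseries J) = 1.
Proof.
apply: ncseriesP => u; rewrite nctildeE !nccoef1.
by rewrite -!size_eq0 size_rev.
Qed.

Lemma nctilde_var a : nctilde (ncvar a : ncseries J) = ncvar a.
Proof.
by apply: ncseriesP => u; rewrite nctildeE /= -[in RHS](inj_eq (can_inj revK)).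
Qed.

Lemma nctilde_int k : nctilde (k%:~R : ncseries J) = k%:~R.
Proof. by apply: etrans (raddfMz _ _ _) _; congr (_ *~ k); exact: nctilde1. Qed.

Lemma ncvar_inv1pC (a : J) : ncvar a * ncinv1p a = ncinv1p a * ncvar a.
Proof.
have [E1 E2] := ncinv1pK a; apply: (@addrI _ (ncinv1p a)).
by rewrite -[X in X + _ = _]mul1r -mulrDl E1 -[X in _ = X + _]mulr1 -mulrDr E2.
Qed.

Lemma nctilde_barvar (a : J) : nctilde (ncbarvar a) = ncbarvar a.
Proof.
rewrite /ncbarvar nctildeM raddfN /= nctilde_var.
have -> : nctilde (ncinv1p a) = ncinv1p a.
  by apply: ncseriesP => u; rewrite nctildeE /= all_rev size_rev.
by rewrite mulrN mulNr ncvar_inv1pC.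
Qed.

Lemma nctilde_prod (I : Type) (g : I -> ncseries J) (w : seq I) :
  nctilde (\prod_(i <- w) g i) = \prod_(i <- rev w) nctilde (g i).
Proof.
elim: w => [|a w IHw]; first by rewrite !big_nil nctilde1.
by rewrite big_cons nctildeM IHw rev_cons -cats1 big_cat big_seq1.
Qed.

Lemma nctilde_ncsum (T : choiceType) (F : T -> ncseries J) :
  nctilde (ncsum F) = ncsum (fun t => nctilde (F t)).
Proof.
apply: ncseriesP => u; rewrite nctildeE.
by apply: eq_fsbigr => t _; rewrite nctildeE.
Qed.

Lemma nctildeZ c f : nctilde (c *: f) = c *: nctilde f.
Proof.
apply: ncseriesP => u; rewrite nctildeE.
by rewrite -[RHS]/(c * nccoef (nctilde f) u) nctildeE.
Qed.

(** How bar decomposes as tilde after hat. *)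
Lemma ncantisubst_tilde (I : choiceType) (g : I -> ncseries J)
    (f : ncseries I) : (forall i, nctilde (g i) = g i) ->
  ncantisubst g f = nctilde (ncsubst g f).
Proof.
move=> gE; rewrite nctilde_ncsum; apply: eq_ncsum => w.
by rewrite nctildeZ nctilde_prod; congr (_ *: _); apply: eq_bigr => i _.
Qed.

Lemma tr_map_tilde_mul (N : nat) (A B : 'M[ncseries J]_N) :
  (map_mx (@nctilde J) (A *m B))^T =
  (map_mx (@nctilde J) B)^T *m (map_mx (@nctilde J) A)^T.
Proof.
apply/matrixP => s t; rewrite !mxE raddf_sum; apply: eq_bigr => r _.
by rewrite !mxE; exact: nctildeM.
Qed.

(** An entrywise anti-automorphism followed by transposition reverses matrix
    products over a noncommutative ring, and reversal is a bijection of the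
    words that index the sum. *)
Lemma tr_map_tilde_eval (I : choiceType) (N : nat)
    (M : I -> 'M[ncseries J]_N) (f : ncseries I) :
  (map_mx (@nctilde J) (ncmxeval M f))^T =
  ncmxeval (fun i => (map_mx (@nctilde J) (M i))^T) (nctilde f).
Proof.
have prodE w : (map_mx (@nctilde J) (\prod_(i <- w) M i))^T =
    \prod_(i <- rev w) (map_mx (@nctilde J) (M i))^T.
  elim: w => [|a w IHw].
    apply/matrixP => s t; rewrite !big_nil !mxE eq_sym.
    by case: eqP; rewrite ?nctilde1 ?raddf0.
  by rewrite big_cons [LHS]tr_map_tilde_mul IHw rev_cons -cats1 big_cat big_seq1.
apply/matrixP => s t; rewrite !mxE nctilde_ncsum; apply: ncseriesP => u.
rewrite [RHS](@reindex_fsbigT _ _ _ _ _ (@rev I)).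
  apply: eq_fsbigr => w _; rewrite nctildeZ nctildeE revK -prodE !mxE //.
by exists rev => ?; rewrite revK.
Qed.

End Tilde.

(** * The involution hat *)

Section Hat.
Variable n : nat.
Implicit Types f g : ncseries 'I_n.

Lemma vanish_barvar (i : 'I_n) : predT i -> vanish_below predT 1 (ncbarvar i).
Proof. exact: vanish_below_barvar. Qed.

Lemma hat_n_zmod : zmod_morphism (@hat_n n).
Proof.
move=> f g; rewrite -ncsumN -ncsumD.
- by apply: eq_ncsum => w; rewrite -scaleNr -scalerDl.
- by apply: summable_filtered (filtered_prod vanish_barvar); exact: finitaryT.
- move=> u; have [X fX] := summable_filtered (finitaryT g)
    (filtered_prod vanish_barvar) u.
  by exists X => w /fX /= ->; rewrite oppr0.
Qed.
HB.instance Definition _ :=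
  GRing.isZmodMorphism.Build (ncseries 'I_n) (ncseries 'I_n) (@hat_n n) hat_n_zmod.

Lemma hat_n_varM i f : hat_n (ncvar i * f) = ncbarvar i * hat_n f.
Proof. by apply: ncsubst_varM vanish_barvar; exact: finitaryT. Qed.

Lemma hat_n1 : hat_n (1 : ncseries 'I_n) = 1.
Proof. by rewrite /hat_n /ncsubst ncsum_one big_nil. Qed.

Lemma hat_n_intM k f : hat_n (k%:~R * f) = k%:~R * hat_n f.
Proof. by rewrite !mulrzl raddfMz. Qed.

(** Applying hat to the entries turns evaluation at M into evaluation at B,
    when hat intertwines left multiplication by M i and by B i: by Fubini the
    claim reduces to words, which are built letter by letter. *)
Lemma map_hat_eval (I : choiceType) (Q : pred I) (N : nat)
    (M B : I -> 'M[ncseries 'I_n]_N) (f : ncseries I) :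
    finitary Q f ->
    (forall i, Q i -> forall s t, vanish_below predT 1 (M i s t)) ->
    (forall i (A : 'M_N),
       map_mx (@hat_n n) (M i *m A) = B i *m map_mx (@hat_n n) A) ->
  map_mx (@hat_n n) (ncmxeval M f) = ncmxeval B f.
Proof.
move=> ff MQ MB; apply/matrixP => s t; rewrite !mxE /hat_n /ncsubst ncsum_comp.
  apply: eq_ncsum => w.
  have -> : \prod_(i <- w) B i = map_mx (@hat_n n) (\prod_(i <- w) M i).
    elim: w => [|a w IHw]; last by rewrite !big_cons IHw [RHS]MB.
    apply/matrixP => i j; rewrite !big_nil !mxE.
    by case: eqP; rewrite ?hat_n1 ?raddf0.
  rewrite mxE -ncsum_scale; apply: eq_ncsum => v.
  by rewrite scalerA.
move=> u; have [X fX] := ff (size u).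
have [Y uY] := finite_words n (size u).
exists X, Y => w v; rewrite /= mulf_eq0 negb_or => /andP[fw Mv] gv.
have vu : (size v <= size u)%N.
  rewrite leqNgt -[X in (_ < X)%N]count_predT; apply: contraNN gv => uv.
  by apply/eqP/(filtered_prod vanish_barvar); rewrite !count_predT in uv *.
split; last exact: uY.
apply: contraNT fw => /fX -> //; apply: leq_trans vu.
rewrite leqNgt; apply: contraNN Mv => vw.
by apply/eqP/(filtered_mxprod MQ); rewrite count_predT.
Qed.

End Hat.

(** * Evaluation at the block scalar matrix X *)

Import tagnat.

Section BlockDiagonal.
Variables (n : nat) (p : 'I_n -> nat).
Let N := (\sum_i p i)%N.
Implicit Types (h : 'I_n -> ncseries 'I_n) (W : 'M[ncseries 'I_n]_N).

Definition blockscalar_mx h : 'M[ncseries 'I_n]_N :=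
  diag_mx (\row_s h (sig1 s)).

Lemma XmxE : Xmx p = blockscalar_mx (@ncvar 'I_n).
Proof.
rewrite /Xmx; transitivity (\mxdiag_i
    diag_mx (const_mx (ncvar i) : 'rV[ncseries 'I_n]_(p i))).
  by apply: eq_mxdiag => i; rewrite diag_const_mx.
by rewrite -diag_mxrow; congr diag_mx; apply/rowP => s; rewrite !mxE.
Qed.

Lemma mul_blockscalar_mx h W s t :
  (blockscalar_mx h *m W) s t = h (sig1 s) * W s t.
Proof. by rewrite mul_diag_mx !mxE. Qed.

Lemma vanish_blockscalar_mx h :
  (forall i, vanish_below predT 1 (h i)) ->
  forall s t, vanish_below predT 1 (blockscalar_mx h s t).
Proof.
move=> hv s t; rewrite !mxE; case: (s == t); first by rewrite mulr1n; exact: hv.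
by rewrite mulr0n.
Qed.

Lemma vanish_lettercase h W : (forall i, vanish_below predT 1 (h i)) ->
  forall l, pred1 Lx l -> forall s t,
    vanish_below predT 1 (lettercase (blockscalar_mx h) W l s t).
Proof. by move=> hv l /eqP ->; exact: vanish_blockscalar_mx. Qed.

Lemma vanish_X W l : pred1 Lx l -> forall s t,
  vanish_below predT 1 (lettercase (Xmx p) W l s t).
Proof.
by rewrite XmxE; apply: vanish_lettercase => i; exact: vanish_below_var.
Qed.

Lemma ncmxeval_1subz W f : finitary (pred1 Lx) f ->
  ncmxeval (lettercase (Xmx p) W) (subst_1subz f) =
  ncmxeval (lettercase (Xmx p) (1%:M - W)) f.
Proof.
move=> ff; apply: (ncmxeval_subst ff _ _ (@vanish_X W)).
- case; first exact: finitary_var.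
  by apply: finitaryD (finitary1 _) _; apply/finitaryN/finitary_var.
- by move=> _ /eqP ->; exact: vanish_below_var.
- case=> r fr /=; first by rewrite (ncmxeval_varM (@vanish_X W)).
  rewrite mulrBl mul1r (ncmxevalD (@vanish_X W)) //; last first.
    exact/finitaryN/finitaryM/fr/finitary_var.
  by rewrite ncmxevalN (ncmxeval_varM (@vanish_X W)) // mulmxBl mul1mx.
Qed.

(** Y, the value of (bar x) r, satisfies (1 + X) Y = - X R because
    (1 + x) bar x = - x; inverting 1 + X block by block gives
    Y = (bar X) R. *)
Lemma ncmxeval_hat W f : finitary (pred1 Lx) f ->
  ncmxeval (lettercase (Xmx p) W) (hat_xz f) =
  ncmxeval (lettercase (blockscalar_mx (@ncbarvar 'I_n)) W) f.
Proof.
move=> ff; apply: (ncmxeval_subst ff _ _ (@vanish_X W)).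
- by case; [exact: finitary_barvar | exact: finitary_var].
- by move=> _ /eqP ->; exact: vanish_below_barvar.
- case=> r fr; last by rewrite (ncmxeval_varM (@vanish_X W)).
  set Y := ncmxeval _ (_ * r); set R := ncmxeval _ r.
  have fbr : finitary (pred1 Lx) (ncbarvar Lx * r).
    by apply: finitaryM fr; exact: finitary_barvar.
  have YE : Y + Xmx p *m Y = - (Xmx p *m R).
    rewrite -!(@ncmxeval_varM _ _ _ _ _ _ (@vanish_X W) _ Lx) //.
    rewrite -(ncmxevalD (@vanish_X W)) //; last first.
      exact/finitaryM/fbr/finitary_var.
    rewrite -ncmxevalN; congr ncmxeval.
    rewrite -{1}[ncbarvar Lx * r]mul1r -mulrDl mulrA /ncbarvar mulNr mulrN.
    by rewrite ncvar_inv1pC mulrA (ncinv1pK Lx).1 mul1r mulNr.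
  (* X is diagonal: (1 + x_i) Y s t = - x_i R s t, with i the block of s. *)
  apply/matrixP => s t; rewrite mul_blockscalar_mx.
  have /matrixP/(_ s t) := YE.
  rewrite XmxE [LHS]mxE [in RHS]mxE !mul_blockscalar_mx.
  rewrite -[X in X + _]mul1r -mulrDl => /(congr1 ( *%R (ncinv1p (sig1 s)))).
  rewrite mulrA (ncinv1pK _).2 mul1r => ->.
  by rewrite mulrN mulrA -ncvar_inv1pC -mulNr -mulNr.
Qed.

Definition int_entries W := forall s t, exists k : int, W s t = k%:~R.

Lemma map_hat_ncmxeval W f : finitary (pred1 Lx) f -> int_entries W ->
  map_mx (@hat_n n) (ncmxeval (lettercase (Xmx p) W) f) =
  ncmxeval (lettercase (blockscalar_mx (@ncbarvar 'I_n)) W) f.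
Proof.
move=> ff Wint; apply: (map_hat_eval ff (@vanish_X W)) => l A.
apply/matrixP => s t; case: l => /=.
  by rewrite XmxE mul_blockscalar_mx mxE mul_blockscalar_mx hat_n_varM [in RHS]mxE.
rewrite !mxE raddf_sum; apply: eq_bigr => r _; rewrite mxE.
by have [k ->] := Wint s r; exact: hat_n_intM.
Qed.

Lemma tr_map_tilde_ncmxeval W f : int_entries W ->
  (map_mx (@nctilde 'I_n) (ncmxeval (lettercase (Xmx p) W) f))^T =
  ncmxeval (lettercase (Xmx p) W^T) (nctilde f).
Proof.
move=> Wint; rewrite tr_map_tilde_eval.
apply: (congr1 (fun M => ncmxeval M _)); apply/funext; case; rewrite /lettercase.
  rewrite XmxE; apply/matrixP => s t; rewrite !mxE eq_sym.
  by case: eqP => [->|_]; [exact: nctilde_var | exact: raddf0].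
apply/matrixP => s t; rewrite !mxE; have [k ->] := Wint t s.
exact: nctilde_int.
Qed.

End BlockDiagonal.

Lemma int_entries_map n (p : 'I_n -> nat) (G : 'M[int]_(\sum_i p i)) :
  int_entries (map_mx intr G).
Proof. by move=> s t; exists (G s t); rewrite mxE. Qed.

Lemma int_entries_Ihalf n (p : 'I_n -> nat) : int_entries (Ihalf p).
Proof.
rewrite /Ihalf -diag_mxrow => s t; rewrite !mxE.
by exists ((odd (sig2 s) && (s == t))%:R%Z); case: odd; case: (s == t).
Qed.

(** * Seifert matrices *)

(** The trace is not cyclic over a noncommutative ring, but integer entries
    are central. *)
Lemma mxtrace_intmulC (R : pzRingType) N (G : 'M[int]_N) (B : 'M[R]_N) :
  \tr (map_mx intr G *m B) = \tr (B *m map_mx intr G).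
Proof.
transitivity (\sum_s \sum_r B r s * (G s r)%:~R).
  by apply: eq_bigr => s _; rewrite mxE; apply: eq_bigr => r _;
     rewrite mxE mulrzr mulrzl.
rewrite exchange_big; apply: eq_bigr => s _; rewrite mxE.
by apply: eq_bigr => r _; rewrite mxE.
Qed.

Section Seifert.
Variables (n : nat) (A : Sei n).
Let p := sei_size A.
Let S : 'M[int]_(\sum_i p i) := sei_mx A - (sei_mx A)^T.

(** From S' = -S and Z S = A: both sides are -A'. *)
Lemma sei_skew_Zmx : S *m (Zmx A)^T = (1%:M - Zmx A) *m S.
Proof.
have ZS : Zmx A *m S = sei_mx A by rewrite mulmxKV ?sei_skew_unit.
have trS : S^T = - S by rewrite linearB /= trmxK opprB.
rewrite [RHS]mulmxBl mul1mx ZS -[S in S *m _]opprK -trS mulNmx -trmx_mul ZS.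
by rewrite /S addrAC subrr sub0r.
Qed.

Lemma sei_skew_block s t : sig1 s != sig1 t -> S s t = 0.
Proof.
move=> st; have /matrixP/(_ (sig2 t) (sig2 s)) := sei_tr A st.
by rewrite !mxE !sig2K => ->; rewrite subrr.
Qed.

Lemma mul_Xmx_skew :
  Xmx p *m map_mx intr S = map_mx intr S *m Xmx p.
Proof.
rewrite XmxE; apply/matrixP => s t.
rewrite mul_blockscalar_mx mul_mx_diag mxE [X in _ = X]mxE !mxE.
have [->|st] := eqVneq (sig1 s) (sig1 t); first by rewrite mulrzr mulrzl.
by have := sei_skew_block st; rewrite !mxE => ->; rewrite mulr0 mul0r.
Qed.

(** The words in X, Z' and in X, 1 - Z are conjugate by the integer matrix S,
    which commutes with X. *)
Lemma mxtrace_ncmxeval_Zmx f : finitary (pred1 Lx) f ->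
  \tr (ncmxeval (lettercase (Xmx p) (map_mx intr (Zmx A))^T) f) =
  \tr (ncmxeval (lettercase (Xmx p) (1%:M - map_mx intr (Zmx A))) f).
Proof.
move=> ff; rewrite !(mxtrace_ncmxeval (@vanish_X _ _ _) ff).
apply: eq_ncsum => w; congr (_ *: _).
set P := \prod_(l <- w) _; set P' := \prod_(l <- w) _.
pose SS : 'M[ncseries 'I_n]_(\sum_i p i) := map_mx intr S.
pose SI : 'M[ncseries 'I_n]_(\sum_i p i) := map_mx intr (invmx S).
have SSI : SS *m SI = 1%:M by rewrite -map_mxM mulmxV ?sei_skew_unit // map_mx1.
have PS : P' *m SS = SS *m P.
  rewrite {}/P {}/P'; elim: w => [|l w IHw].
    by rewrite !big_nil mulmx1 mul1mx.
  rewrite !big_cons -mulmxA IHw !mulmxA; congr (_ *m _); case: l => /=.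
    exact: mul_Xmx_skew.
  rewrite map_trmx -map_mxM sei_skew_Zmx [RHS]map_mxM; congr (_ *m _).
  by rewrite map_mxB map_mx1.
have -> : P' = SS *m P *m SI by rewrite -PS -mulmxA SSI mulmx1.
by rewrite -mxtrace_intmulC mulmxA -map_mxM mulVmx ?sei_skew_unit // map_mx1 mul1mx.
Qed.

(** An alternating matrix M - M' of odd size has determinant equal to its own
    opposite, which 1 is not. *)
Lemma sei_size_even i : ~~ odd (p i).
Proof.
apply/negP => po; have := sei_det A i.
set M := submxblock _ _ _ => detS.
have : \det (M - M^T) = - \det (M - M^T).
  rewrite -[in LHS]det_tr linearB /= trmxK -opprB -scaleN1r detZ.
  by rewrite -signr_odd po expr1 mulN1r.
by rewrite detS.
Qed.

End Seifert.

Lemma card_even m : ~~ odd m -> (#|[set k : 'I_m | ~~ odd k]|.*2 = m)%N.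
Proof.
move=> me; rewrite -[RHS](even_halfK me); congr (_.*2).
rewrite -sum1_card big_mkcond /=.
under eq_bigr do rewrite inE.
rewrite -(big_mkord xpredT (fun k => if ~~ odd k then 1 else 0)%N).
rewrite -[X in index_iota 0 X](even_halfK me).
elim: m./2 => [|q IHq]; first by rewrite big_geq.
by rewrite doubleS !big_nat_recr //= IHq odd_double /= addn0 addn1.
Qed.

(** * The behaviour of chi under the involutions *)

(** Both sides are the trace of f(bar X, Z) - f(bar X, I_1/2). *)
Lemma hat_chi n f (A : Sei n) : finitary (pred1 Lx) f ->
  chi (hat_xz f) A = hat_n (chi f A).
Proof.
move=> ff; rewrite /chi !ncmxeval_hat //.
rewrite -!map_hat_ncmxeval //; [|exact: int_entries_Ihalf|exact: int_entries_map].
rewrite /mxtrace raddf_sum; apply: eq_bigr => s _; rewrite !mxE.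
exact/esym/raddfB.
Qed.

(** The I_1/2 on the right is replaced by its complement, with 1 at the even
    places of each block, so that substituting 1 - z restores the one on the
    left. *)
Lemma tilde_chi n f (A : Sei n) : finitary (pred1 Lx) f ->
  nctilde (chi f A) = chi (subst_1subz (nctilde f)) A.
Proof.
move=> ff; have ft := finitary_tilde ff.
rewrite [RHS](chi_indep _
    (d := fun i => [set k : 'I_(sei_size A i) | ~~ odd k])); last first.
  by move=> i; apply/card_even/sei_size_even.
do 2! (rewrite ncmxeval_1subz; last exact: ft).
set W := map_mx intr (Zmx A).
have -> : 1%:M - \mxdiag_(i < n) diag_mx (\row_k (k \in
    [set k : 'I_(sei_size A i) | ~~ odd k])%:R) = Ihalf (sei_size A)
    :> 'M[ncseries 'I_n]_(\sum_i sei_size A i).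
  rewrite -mxdiagZ -mxdiagB; apply: eq_mxdiag => i; apply/matrixP => s t.
  rewrite !mxE inE; case: (s == t); last by rewrite !mulr0n subrr.
  by rewrite !mulr1n; case: odd; rewrite /= ?subr0 ?subrr.
pose E V := ncmxeval (lettercase (Xmx (sei_size A)) V) f.
transitivity (\tr (map_mx (@nctilde 'I_n) (E W))^T -
              \tr (map_mx (@nctilde 'I_n) (E (Ihalf (sei_size A))))^T).
  rewrite /chi !mxtrace_tr /mxtrace -sumrB raddf_sum.
  by apply: eq_bigr => s _; rewrite !mxE; exact: raddfB.
rewrite !tr_map_tilde_ncmxeval; [|exact: int_entries_Ihalf|exact: int_entries_map].
rewrite mxtrace_ncmxeval_Zmx //.
have -> : (Ihalf (sei_size A))^T = Ihalf (sei_size A).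
  by rewrite /Ihalf -diag_mxrow tr_diag_mx.
by rewrite /mxtrace -sumrB; apply: eq_bigr => s _; rewrite !mxE.
Qed.

Lemma bar_n_tilde n (g : ncseries 'I_n) : bar_n g = nctilde (hat_n g).
Proof. by apply: ncantisubst_tilde => i; exact: nctilde_barvar. Qed.

Lemma bar_xz_tilde f : bar_xz f = nctilde (hat_xz f).
Proof.
by apply: ncantisubst_tilde => -[]; [exact: nctilde_barvar | exact: nctilde_var].
Qed.

Theorem proposition1p3 (f : ncseries letter) (hf : admissible f)
    (n : nat) (hn : (1 <= n)%N) :
  [/\ forall A : Sei n, nctilde (chi f A) = chi (subst_1subz (nctilde f)) A,
      forall A : Sei n, chi (hat_xz f) A = hat_n (chi f A)
    & forall A : Sei n, bar_n (chi f A) = chi (subst_1subz (bar_xz f)) A].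
Proof.
have ff := finitary_admissible hf.
split=> A; [exact: tilde_chi | exact: hat_chi |].
rewrite bar_n_tilde bar_xz_tilde -hat_chi // tilde_chi //.
apply: finitary_subst ff _ _ => [|_ /eqP ->]; last exact: vanish_below_barvar.
by case; [exact: finitary_barvar | exact: finitary_var].
Qed.
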